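(* Let $\mathcal G_0\subseteq\mathcal M^{n\times n}$ and let $\circ$ be an operation such that $(\mathcal G_0,\circ)$ is a group; write $(\circ\mathbf A)^{-1}$ for the inverse of $\mathbf A\in\mathcal G_0$ with respect to $\circ$. Let $\mathfrak D,\widetilde{\mathfrak D}\subset\mathbb C$ be two stability regions such that, for every $\mathbf A\in\mathcal G_0$, $$\sigma(\mathbf A)\subset\mathfrak D\ \text{ implies }\ \sigma((\circ\mathbf A)^{-1})\subset\widetilde{\mathfrak D}.$$ Let $\mathcal G\subseteq\mathcal G_0$ be a matrix class and $\mathcal G^{-1}:=\{(\circ\mathbf G)^{-1}:\mathbf G\in\mathcal G\}$. Then for every $\mathbf A\in\mathcal G_0$: if $\mathbf A$ is left $(\mathfrak D,\mathcal G,\circ)$-stable, then $(\circ\mathbf A)^{-1}$ is right $(\widetilde{\mathfrak D},\mathcal G^{-1},\circ)$-stable. If, in addition, for every $\mathbf A\in\mathcal G_0$, $\sigma((\circ\mathbf A)^{-1})\subset\widetilde{\mathfrak D}$ implies $\sigma(\mathbf A)\subset\mathfrak D$, the class $\mathcal G$ is closed with respect to $\circ$-inversion, and $\sigma(\mathbf G\circ\mathbf A)=\sigma(\mathbf A\circ\mathbf G)$ for all $\mathbf A\in\mathcal G_0$ and $\mathbf G\in\mathcal G$, then $\mathbf A\in\mathcal G_0$ is (left) $(\mathfrak D,\mathcal G,\circ)$-stable if and only if $(\circ\mathbf A)^{-1}$ is (left) $(\widetilde{\mathfrak D},\mathcal G,\circ)$-stable.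
   Context: $\mathcal M^{n\times n}$ denotes the set of real $n\times n$ matrices and $\sigma(\mathbf A)\subset\mathbb C$ the spectrum (set of complex eigenvalues) of $\mathbf A$. A stability region is a set $\mathfrak D\subseteq\mathbb C$ such that $\lambda\in\mathfrak D$ implies $\overline\lambda\in\mathfrak D$. A matrix class is a subset of $\mathcal M^{n\times n}$. A matrix $\mathbf A$ is called left (respectively right) $(\mathfrak D,\mathcal G,\circ)$-stable if $\sigma(\mathbf G\circ\mathbf A)\subset\mathfrak D$ (respectively $\sigma(\mathbf A\circ\mathbf G)\subset\mathfrak D$) for every $\mathbf G\in\mathcal G$; ''$(\mathfrak D,\mathcal G,\circ)$-stable'' without qualifier means left stable. The operation $\circ$ is understood to be defined on a set $\mathcal G_0\subseteq\mathcal M^{n\times n}$ containing $\mathcal G$ (for example, all of $\mathcal M^{n\times n}$ with addition, or the nonsingular matrices with multiplication). *)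

(* Defs.v *)
From mathcomp Require Import all_boot all_order all_algebra.
From mathcomp Require Import boolp classical_sets reals.
From mathcomp Require Import complex.

Set Implicit Arguments.
Unset Strict Implicit.
Unset Printing Implicit Defensive.

Import Order.TTheory GRing.Theory Num.Theory.
Local Open Scope classical_set_scope.
Local Open Scope complex_scope.
Local Open Scope ring_scope.

Definition spectrum (R : realType) (n : nat) (A : 'M[R]_n) : set R[i] :=
  [set z | eigenvalue (map_mx (real_complex R) A) z].

Definition stability_region (R : realType) (D : set R[i]) : Prop :=
  forall z : R[i], D z -> D (conjc z).

(* A binary operation defined on G0 is encoded by a total function on matrices
   of which only the restriction to G0 is constrained: its values outside
   G0 x G0 are arbitrary, as are those of [inv] outside G0.  The neutral
   element [e], and [inv] on G0, are determined by [op]. *)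
Record group_on (T : Type) (G0 : set T) (op : T -> T -> T) (e : T)
    (inv : T -> T) : Prop := GroupOn {
  group_on_op : forall A B, G0 A -> G0 B -> G0 (op A B);
  group_on_assoc : forall A B C, G0 A -> G0 B -> G0 C ->
    op A (op B C) = op (op A B) C;
  group_on_one : G0 e;
  group_on_op1l : forall A, G0 A -> op e A = A;
  group_on_op1r : forall A, G0 A -> op A e = A;
  group_on_inv : forall A, G0 A -> G0 (inv A);
  group_on_opVl : forall A, G0 A -> op (inv A) A = e;
  group_on_opVr : forall A, G0 A -> op A (inv A) = e
}.

Definition left_stable (R : realType) (n : nat) (D : set R[i])
    (G : set 'M[R]_n) (op : 'M[R]_n -> 'M[R]_n -> 'M[R]_n)
    (A : 'M[R]_n) : Prop :=
  forall M, G M -> spectrum (op M A) `<=` D.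

Definition right_stable (R : realType) (n : nat) (D : set R[i])
    (G : set 'M[R]_n) (op : 'M[R]_n -> 'M[R]_n -> 'M[R]_n)
    (A : 'M[R]_n) : Prop :=
  forall M, G M -> spectrum (op A M) `<=` D.

(* Main.v *)
Require Import Defs.
From mathcomp Require Import all_boot all_order all_algebra.
From mathcomp Require Import boolp classical_sets reals.
From mathcomp Require Import complex.

Import Order.TTheory GRing.Theory Num.Theory.
Local Open Scope classical_set_scope.
Local Open Scope ring_scope.

(** Inversion in a group reverses products: the inverse of [op M A] is [op (inv A) (inv M)]
    ([group_on_inv_op]). So [hinv], applied to [op M A], carries left stability of [A] to right
    stability of [inv A] over the inverted class. When [G] is closed under [inv] and spectra ignore
    the order of the factors, right stability over the inverses becomes left stability over [G], and
    the converse spectral implication makes the argument reversible. *)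

(** [op (inv B) (inv A)] is a right inverse of [op A B]; composing with [inv (op A B)] on the left
    identifies the two. The laws hold only on [G0], hence the membership facts collected first. *)
Lemma group_on_inv_op {T : Type} {G0 : set T} {op : T -> T -> T} {e : T}
    {inv : T -> T} (hgroup : group_on G0 op e inv) (A B : T) :
  G0 A -> G0 B -> inv (op A B) = op (inv B) (inv A).
Proof.
case: hgroup => opG opA _ op1l op1r invG opVl opVr GA GB.
have GVA := invG _ GA; have GVB := invG _ GB; have GAB := opG _ _ GA GB.
have GVAB := invG _ GAB; have GVBVA := opG _ _ GVB GVA.
have opABV : op (op A B) (op (inv B) (inv A)) = e.
  by rewrite opA // -(opA A B) // opVr // op1r // opVr.
by rewrite -(op1r _ GVAB) -opABV opA // opVl // op1l.
Qed.

Lemma group_on_invK {T : Type} {G0 : set T} {op : T -> T -> T} {e : T}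
    {inv : T -> T} (hgroup : group_on G0 op e inv) (A : T) :
  G0 A -> inv (inv A) = A.
Proof.
case: hgroup => _ opA _ op1l op1r invG opVl _ GA.
have GVA := invG _ GA; have GVVA := invG _ GVA.
by rewrite -(op1r _ GVVA) -(opVl _ GA) opA // opVl // op1l.
Qed.

Theorem theorem10 (R : realType) (n : nat)
    (G0 : set 'M[R]_n) (op : 'M[R]_n -> 'M[R]_n -> 'M[R]_n)
    (e : 'M[R]_n) (inv : 'M[R]_n -> 'M[R]_n)
    (hgroup : group_on G0 op e inv)
    (D D' : set R[i])
    (hD : stability_region D) (hD' : stability_region D')
    (hinv : forall A : 'M[R]_n, G0 A ->
      spectrum A `<=` D -> spectrum (inv A) `<=` D')
    (G : set 'M[R]_n) (hG : G `<=` G0) :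
  (forall A : 'M[R]_n, G0 A ->
     left_stable D G op A -> right_stable D' (inv @` G) op (inv A))
  /\
  ((forall A : 'M[R]_n, G0 A ->
      spectrum (inv A) `<=` D' -> spectrum A `<=` D) ->
   (forall M : 'M[R]_n, G M -> G (inv M)) ->
   (forall A M : 'M[R]_n, G0 A -> G M -> spectrum (op M A) = spectrum (op A M)) ->
   forall A : 'M[R]_n, G0 A ->
     (left_stable D G op A <-> left_stable D' G op (inv A))).
Proof.
have opG := group_on_op hgroup; have invG := group_on_inv hgroup.
have invM := group_on_inv_op hgroup; have invK := group_on_invK hgroup.
split=> [A GA stA _ [M GM <-]|hinv' GV specC A GA].
  have G0M := hG _ GM.
  by rewrite -invM //; apply: hinv; [exact: opG|exact: stA].
split=> stA M GM; have G0M := hG _ GM; have GVM := GV _ GM.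
  have G0VM := hG _ GVM.
  (* Reading [M] as [inv (inv M)] turns the product into the inverse of [op A (inv M)]; [specC] then
     swaps these factors, so that stability of [A] applies to [inv M], a member of [G]. *)
  rewrite -{1}(invK _ G0M) -invM //; apply: hinv; first exact: opG.
  by rewrite -specC //; exact: stA.
(* Conversely, the inverse of [op M A] has the spectrum of [op (inv M) (inv A)], which stability of
   [inv A] controls. *)
apply: hinv'; first exact: opG.
by rewrite invM // -specC //; [exact: stA|exact: invG].
Qed.
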